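(* Let $(M_n(x,q))_{n\ge0}$ be the generalized $q$-Morgan-Voyce polynomials with arbitrary initial values $M_0(x,q)$, $M_1(x,q)$. For every integer $n\ge 2$, $$M_n(x,q)=\det(\widetilde{D}_n(x,q)),$$ where $\widetilde{D}_n(x,q)$ is the $n\times n$ tridiagonal matrix $$\widetilde{D}_{n}(x,q)=\begin{pmatrix} M_{1}(x,q) & M_{0}(x,q) & & & & \\ 1 & x+1+q & q & & & \\ & 1 & x+1+q & q^{2} & & \\ & & 1 & \ddots & \ddots & \\ & & & \ddots & \ddots & q^{n-2}\\ & & & & 1 & x+1+q \end{pmatrix},$$ that is, with rows and columns indexed $1,\dots,n$: the $(1,1)$ entry is $M_1(x,q)$, the $(1,2)$ entry is $M_0(x,q)$, the $(i,i)$ entry is $x+1+q$ for $2\le i\le n$, the $(i,i+1)$ entry is $q^{i-1}$ for $2\le i\le n-1$, the $(i+1,i)$ entry is $1$ for $1\le i\le n-1$, and all other entries are $0$.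
   Context: Here $x,q$ are complex numbers with $q\neq 1$. The generalized $q$-Morgan-Voyce polynomials are defined, for arbitrary initial values $M_0(x,q)$, $M_1(x,q)$, by $M_{n}(x,q)=(x+1+q)M_{n-1}(x,q)-q^{n-2}M_{n-2}(x,q)$ for $n\ge 2$. *)

(* Defs.v *)
From mathcomp Require Import all_boot all_order all_algebra.

Set Implicit Arguments.
Unset Strict Implicit.
Unset Printing Implicit Defensive.

Import GRing.Theory.
Local Open Scope ring_scope.

(* M0 and M1 are the arbitrary initial values, as functions of (x, q). *)
Fixpoint qMorganVoyce (K : comNzRingType) (M0 M1 : K -> K -> K) (n : nat)
    (x q : K) {struct n} : K :=
  match n with
  | 0 => M0 x q
  | 1 => M1 x q
  | (n''.+1 as n').+1 =>
      (x + 1 + q) * qMorganVoyce M0 M1 n' x q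
      - q ^+ n'' * qMorganVoyce M0 M1 n'' x q
  end.

Lemma qMorganVoyce_rec (K : comNzRingType) (M0 M1 : K -> K -> K) (n : nat)
    (x q : K) : (2 <= n)%N ->
  qMorganVoyce M0 M1 n x q =
    (x + 1 + q) * qMorganVoyce M0 M1 (n - 1) x q
    - q ^+ (n - 2) * qMorganVoyce M0 M1 (n - 2) x q.
Proof. by case: n => [|[|n]] // _; rewrite subn1 subn2. Qed.

(* Rows and columns are numbered from 0, so the usual superdiagonal entry
   q^(i-1) in row i (numbered from 1) becomes q ^+ i. *)
Definition qMorganVoyce_mx (K : comNzRingType) (M0 M1 : K -> K -> K) (n : nat)
    (x q : K) : 'M[K]_n :=
  \matrix_(i < n, j < n)
    if (i == 0%N :> nat) && (j == 0%N :> nat) then M1 x q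
    else if (i == 0%N :> nat) && (j == 1%N :> nat) then M0 x q
    else if i == j :> nat then x + 1 + q
    else if j == i.+1 :> nat then q ^+ i
    else if i == j.+1 :> nat then 1
    else 0.

(* Main.v *)
(* Expanding a tridiagonal determinant along its last row, and the resulting
   off-diagonal minor along its last column, gives the continuant three-term
   recurrence, which is the recurrence defining M_n. *)
Require Import Defs.
From mathcomp Require Import all_boot all_order all_algebra reals complex.
From mathcomp Require Import zify ring.

Set Implicit Arguments.
Unset Strict Implicit.
Unset Printing Implicit Defensive.

Import GRing.Theory.
Local Open Scope ring_scope.
Local Open Scope complex_scope.

(** Drawing the entries from one function on [nat] makes the leading blocks of all sizes
    restrictions of the same [f], so the recurrence can be iterated. *)
Lemma det_tridiag_rec (K : comNzRingType) (f : nat -> nat -> K) (n : nat) :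
  (forall i j : nat, (i.+1 < j)%N || (j.+1 < i)%N -> f i j = 0) ->
  \det (\matrix_(i < n.+2, j < n.+2) f i j) =
    f n.+1 n.+1 * \det (\matrix_(i < n.+1, j < n.+1) f i j)
    - f n n.+1 * f n.+1 n * \det (\matrix_(i < n, j < n) f i j).
Proof.
move=> f0; rewrite (expand_det_row _ ord_max) 2!big_ord_recr /=.
rewrite big1 ?add0r => [|j _]; last first.
  by rewrite mxE f0 ?mul0r //=; have := ltn_ord j; lia.
have -> : cofactor (\matrix_(i < n.+2, j < n.+2) f i j) ord_max ord_max
    = \det (\matrix_(i < n.+1, j < n.+1) f i j).
  rewrite /cofactor /= -signr_odd addnn odd_double mul1r; congr (\det _).
  by apply/matrixP=> i j; rewrite !mxE !lift_max.
have -> : cofactor (\matrix_(i < n.+2, j < n.+2) f i j) ord_max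
      (widen_ord (leqnSn n.+1) ord_max)
    = - (f n n.+1 * \det (\matrix_(i < n, j < n) f i j)).
  rewrite /cofactor /= -signr_odd addSn /= addnn odd_double mulN1r.
  (* With column [n] deleted, column [n.+1] comes last in the minor, and its only possibly nonzero
     entry is the bottom one, [f n n.+1]. *)
  congr (- _); rewrite (expand_det_col _ ord_max) big_ord_recr /=.
  rewrite big1 ?add0r => [|i _]; last first.
    by rewrite !mxE f0 ?mul0r //= /bump; have := ltn_ord i; lia.
  rewrite !mxE lift_max /= /bump leqnn add1n; congr (_ * _).
  rewrite /cofactor /= -signr_odd addnn odd_double mul1r; congr (\det _).
  (* All remaining indices are below [n], where [bump] shifts nothing. *)
  apply/matrixP=> i j; rewrite !mxE !lift_max /= /bump.
  by congr (f _ _); have := ltn_ord i; have := ltn_ord j; lia.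
by rewrite !mxE /=; ring.
Qed.

(** Sizes start at 1 because the empty determinant is 1 rather than [M0 x q]. *)
Lemma qMorganVoyce_det (K : comNzRingType) (M0 M1 : K -> K -> K) (x q : K)
    (n : nat) :
  qMorganVoyce M0 M1 n.+1 x q = \det (qMorganVoyce_mx M0 M1 n.+1 x q).
Proof.
pose f i j : K :=
  if (i == 0%N) && (j == 0%N) then M1 x q
  else if (i == 0%N) && (j == 1%N) then M0 x q
  else if i == j then x + 1 + q
  else if j == i.+1 then q ^+ i
  else if i == j.+1 then 1
  else 0.
have f0 i j : (i.+1 < j)%N || (j.+1 < i)%N -> f i j = 0.
  by move=> ij; rewrite /f; do !case: ifP => ? //; lia.
have detE m : \det (qMorganVoyce_mx M0 M1 m x q)
    = \det (\matrix_(i < m, j < m) f i j) by [].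
elim/ltn_ind: n => -[|[|n]] IH; rewrite detE.
- by rewrite det_mx11 mxE.
(* At size 2 the term [M0 x q] comes from the corner entry [f 0 1], multiplied by the empty
   determinant 1; this matches the coefficient [q ^+ 0] in the recurrence. *)
- rewrite det_tridiag_rec // det_mx00 det_mx11 mxE /f /=; ring.
(* From size 3 on, both smaller blocks are nonempty, so strong induction applies to each; the
   entries in the last corner then give the coefficients of the recurrence. *)
rewrite det_tridiag_rec // -!detE -!IH //.
have -> : f n.+2 n.+2 = x + 1 + q by rewrite /f /= eqxx.
have -> : f n.+1 n.+2 = q ^+ n.+1 by rewrite /f /= !eqSS ltn_eqF // eqxx.
have -> : f n.+2 n.+1 = 1.
  by rewrite /f /= !eqSS gtn_eqF // eqxx ltn_eqF //; lia.
by rewrite mulr1.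
Qed.

Theorem theorem22 (R : realType) (M0 M1 : R[i] -> R[i] -> R[i])
    (x q : R[i]) (hq : q != 1) (n : nat) (hn : (2 <= n)%N) :
  qMorganVoyce M0 M1 n x q = \det (qMorganVoyce_mx M0 M1 n x q).
Proof. by case: n hn => [|n] // _; exact: qMorganVoyce_det. Qed.
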